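(* Let $(\xi,\eta)\in\mathbb{C}^2\setminus\{0\}$ be a nonzero spinor. Under the correspondence $\widetilde{\mathbf K}$ between nonzero spinors and spin-decorated horospheres (defined in the context), $(\xi,\eta)$ corresponds to a horosphere in the upper half space model $\mathbb{U}$, centred at $\xi/\eta\in\mathbb{C}\cup\{\infty\}$, with a spin decoration, such that: (i) if $\eta\neq0$, then the horosphere appears in $\mathbb{U}$ as a sphere with Euclidean diameter $|\eta|^{-2}$, and its decoration is specified at the north pole by $i\eta^{-2}$; (ii) if $\eta=0$, then the horosphere appears in $\mathbb{U}$ as a plane at height $|\xi|^2$, and its decoration is specified by $i\xi^2$.
   Context: **Spinors, Hermitian matrices, Minkowski space.** A spinor is a vector $\kappa=(\xi,\eta)\in\mathbb{C}^2$, regarded as a column vector; $\mathbb{C}^2_\times=\mathbb{C}^2\setminus\{0\}$. $\mathcal{H}$ is the real vector space of $2\times2$ Hermitian matrices and $\mathcal{H}_0^+=\{S\in\mathcal{H}:\det S=0,\ \mathrm{Trace}\,S>0\}$. $\mathbb{R}^{1,3}$ has coordinates $(T,X,Y,Z)$ and inner product $\langle p,p'\rangle=TT'-XX'-YY'-ZZ'$; $L^+=\{p:\langle p,p\rangle=0,\ T>0\}$. The linear isomorphism $\mathbf g\colon\mathcal{H}\to\mathbb{R}^{1,3}$ is $\mathbf g\begin{pmatrix}a&b+ci\\ b-ci&d\end{pmatrix}=(a+d,2b,2c,a-d)$; it restricts to a bijection $\mathcal{H}_0^+\to L^+$. Let $\mathbf f(\kappa)=\kappa\kappa^*$, which maps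 $\mathbb{C}^2_\times$ to $\mathcal{H}_0^+$, with real derivative $D_\kappa\mathbf f(\nu)=\kappa\nu^*+\nu\kappa^*$, and let $\mathcal{Z}(\xi,\eta)=(i\overline\eta,-i\overline\xi)$. **Flags.** A (pointed oriented null) flag in $\mathbb{R}^{1,3}$ (resp. $\mathcal{H}$) is a triple $(p,V,o)$ with $p\in L^+$ (resp. $p\in\mathcal{H}_0^+$), $V$ a 2-dimensional real subspace spanned by $p$ and some $v$ in the tangent space at $p$ to $L^+$ (resp. $\mathcal{H}_0^+$), and $o$ an orientation of the line $V/\mathbb{R}p$. For such linearly independent $p,v$, $[[p,v]]$ is the flag with $V=\mathrm{span}(p,v)$ and $o$ represented by $v+\mathbb{R}p$. The sets of flags are $\mathcal{F}_P^O(\mathbb{R}^{1,3})$, $\mathcal{F}_P^O(\mathcal{H})$. Define $\mathbf F(\kappa)=[[\mathbf f(\kappa),D_\kappa\mathbf f(\mathcal{Z}(\kappa))]]$ for $\kappa\in\mathbb{C}^2_\times$ and $\mathbf G(S,V,o)=(\mathbf g(S),\mathbf g(V),\mathbf g(o))$. **Horospheres and decorations.** The hyperboloid model is $\mathbb{H}=\{x\in\mathbb{R}^{1,3}:\langle x,x\rangle=1,\ T>0\}$ with metric $dX^2+dY^2+dZ^2-dT^2$. For $p\in L^+$, $\mathbf h(p)=\{x\in\mathbb{H}:\langle x,p\rangle=1\}$ is a horosphere (all horospheres arise uniquely this way), with centre the point of $\partial\mathbb{H}$ given by the ray through $p$. A decorated horosphere is a horosphere together with an oriented tangent line field on it (its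 decoration) which is parallel, i.e. invariant under all parabolic isometries preserving the horosphere; the set of these is $\mathfrak{H}_D$. $\mathbf H\colon\mathcal{F}_P^O(\mathbb{R}^{1,3})\to\mathfrak{H}_D(\mathbb{H})$ sends $(p,V,o)$ to $\mathbf h(p)$ with the line field $V\cap T_q\mathbf h(p)$, $q\in\mathbf h(p)$, each line oriented via its isomorphic projection to $(V/\mathbb{R}p,o)$. $\mathbb{D}$ is the conformal unit ball model and $\mathbb{U}=\{(x,y,z):z>0\}$ the upper half space model with metric $(dx^2+dy^2+dz^2)/z^2$ and $\partial\mathbb{U}=\mathbb{C}\cup\{\infty\}$ (with $(x,y,0)\leftrightarrow x+yi$). $\mathbf i\colon\mathbb{H}\to\mathbb{D}$, $\mathbf i(T,X,Y,Z)=\frac1{1+T}(X,Y,Z)$, and $\mathbf j\colon\mathbb{D}\to\mathbb{U}$ is the isometry extending $\partial\mathbb{D}\to\partial\mathbb{U}$, $(x,y,z)\mapsto\frac{x+iy}{1-z}$. $\mathbf I,\mathbf J$ are the maps on decorated horospheres induced by $\mathbf i,\mathbf j$ and their derivatives, and $\mathbf K=\mathbf J\circ\mathbf I\circ\mathbf H\circ\mathbf G\circ\mathbf F\colon\mathbb{C}^2_\times\to\mathfrak{H}_D(\mathbb{U})$. **Specifications.** A horosphere in $\mathbb{U}$ centred at $\infty$ is a horizontal plane $z=$ const; its tangent spaces are identified with $\mathbb{C}$ ($(a,b,0)\leftrightarrow a+bi$), and a decoration is specified by a nonzero complex number directing the oriented line field at any point. A horosphere with centre in $\mathbb{C}$ is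 a Euclidean sphere tangent to $\mathbb{C}$ at its centre; its tangent space at its highest point (north pole) is identified with $\mathbb{C}$ in the same way, and a decoration is specified at the north pole by a nonzero complex number directing the oriented line field there. Specifications are defined up to positive real multiples. **Spin decorations.** A frame is a right-handed orthonormal frame $(f_1,f_2,f_3)$ at a point of $\mathbb{H}^3$. $\mathrm{Fr}\to\mathbb{H}^3$ is the principal $SO(3)$ bundle of frames and $\mathrm{Spin}$ its double (universal) cover, whose points are spin frames. On a horosphere, $N^{out}$ is the unit normal field pointing towards its centre and $N^{in}=-N^{out}$. For a unit parallel tangent vector field $\mathcal V$ on a horosphere, $f^{out}(\mathcal V)=(N^{out},\mathcal V,N^{out}\times\mathcal V)$ and $f^{in}(\mathcal V)=(N^{in},\mathcal V,N^{in}\times\mathcal V)$. An outward (inward) spin decoration is a continuous lift to $\mathrm{Spin}$ of some $f^{out}(\mathcal V)$ ($f^{in}(\mathcal V)$). The inward spin decoration associated to an outward one $W^{out}$ is obtained by rotating $W^{out}$ by angle $\pi$ about $\mathcal V$ at each point; the outward one associated to $W^{in}$ is obtained by rotating $W^{in}$ by $-\pi$ about $\mathcal V$. A spin decoration is a pair $W=(W^{in},W^{out})$, each associated to the other. $\mathfrak{H}_D^S$ is the set of spin-decorated horospheres; the map sending $(W^{in},W^{out})$ to the decoration directed by $\mathcal V$ is a double (universal) covering $\mathfrak{H}_D^S\to\mathfrak{H}_D$, and ''its decoration'' in the claim refers to this underlying decoration. **The map $\widetilde{\mathbf K}$.** Since $\mathbb{C}^2_\times$ is simply connected, $\mathbf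 K$ lifts to a map $\widetilde{\mathbf K}\colon\mathbb{C}^2_\times\to\mathfrak{H}_D^S(\mathbb{U})$; fix such a lift. The spin-decorated horosphere corresponding to $\kappa$ is $\widetilde{\mathbf K}(\kappa)$. *)

(* Defs.v *)
From HB Require Import structures.
From mathcomp Require Import all_boot all_order all_algebra.
From mathcomp Require Import complex.
From mathcomp Require Import all_classical all_reals all_analysis.
From mathcomp Require Import ring lra.

Set Implicit Arguments.
Unset Strict Implicit.
Unset Printing Implicit Defensive.

Import Order.TTheory GRing.Theory Num.Theory.
Import numFieldNormedType.Exports.

Local Open Scope classical_set_scope.
Local Open Scope ring_scope.

Definition vec3 (R : realType) (x y z : R) : 'rV[R]_3 :=
  \row_(k < 3) [:: x; y; z]`_k.

Lemma vec3E (R : realType) (x y z : R) :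
  (vec3 x y z 0 0 = x) * (vec3 x y z 0 1 = y) * (vec3 x y z 0 2 = z).
Proof. by rewrite !mxE. Qed.

Lemma row3P (R : realType) (u v : 'rV[R]_3) :
  u 0 0 = v 0 0 -> u 0 1 = v 0 1 -> u 0 2 = v 0 2 -> u = v.
Proof.
move=> e0 e1 e2; apply/rowP => -[[|[|[|//]]] Hk]; last 1 first.
- by rewrite (_ : Ordinal Hk = 2) //; apply: val_inj.
- by rewrite (_ : Ordinal Hk = 0) //; apply: val_inj.
- by rewrite (_ : Ordinal Hk = 1) //; apply: val_inj.
Qed.

Definition vec4 (R : realType) (t x y z : R) : 'rV[R]_4 :=
  \row_(k < 4) [:: t; x; y; z]`_k.

Definition dot3 (R : realType) (u v : 'rV[R]_3) : R :=
  u 0 0 * v 0 0 + u 0 1 * v 0 1 + u 0 2 * v 0 2.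

Definition cross3 (R : realType) (u v : 'rV[R]_3) : 'rV[R]_3 :=
  vec3 (u 0 1 * v 0 2 - u 0 2 * v 0 1)
       (u 0 2 * v 0 0 - u 0 0 * v 0 2)
       (u 0 0 * v 0 1 - u 0 1 * v 0 0).

Definition spinor (R : realType) (xi eta : R[i]) : 'cV[R[i]]_2 :=
  \col_(k < 2) [:: xi; eta]`_k.

Definition adjmx (R : realType) m n (A : 'M[R[i]]_(m, n)) : 'M[R[i]]_(n, m) :=
  (map_mx (@conjc R) A)^T.

Definition f_map (R : realType) (kappa : 'cV[R[i]]_2) : 'M[R[i]]_2 :=
  kappa *m adjmx kappa.

(** The real derivative of [f_map] at [kappa] in the direction [nu]. *)
Definition Df_map (R : realType) (kappa nu : 'cV[R[i]]_2) : 'M[R[i]]_2 :=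
  kappa *m adjmx nu + nu *m adjmx kappa.

Definition Z_map (R : realType) (kappa : 'cV[R[i]]_2) : 'cV[R[i]]_2 :=
  spinor (Complex 0 1 * conjc (kappa 1 0)) (- (Complex 0 1 * conjc (kappa 0 0))).

(** On a Hermitian matrix with rows [(a, b + ci)] and [(b - ci, d)] this is
    [(a + d, 2b, 2c, a - d)], in coordinates [(T, X, Y, Z)]. *)
Definition g_map (R : realType) (S : 'M[R[i]]_2) : 'rV[R]_4 :=
  let a := complex.Re (S 0 0) in
  let b := complex.Re (S 0 1) in
  let c := complex.Im (S 0 1) in
  let d := complex.Re (S 1 1) in
  vec4 (a + d) (2 * b) (2 * c) (a - d).

Definition mink (R : realType) (p q : 'rV[R]_4) : R :=
  p 0 0 * q 0 0 - p 0 1 * q 0 1 - p 0 2 * q 0 2 - p 0 3 * q 0 3.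

(** A flag [(p, V, o)].  The orientation [o] of the line [V / Rp] is encoded by
    the open half-plane of those [v] in [V] whose class is positive for [o]. *)
Record flag (E : Type) := Flag {
  flag_pt : E;
  flag_plane : set E;
  flag_orient : set E }.

(** [[p, v]] in the space of Hermitian matrices; all scalars are real. *)
Definition flag_of (R : realType) (p v : 'M[R[i]]_2) : flag 'M[R[i]]_2 :=
  Flag p
    [set S | exists a b : R, S = Complex a 0 *: p + Complex b 0 *: v]
    [set S | exists a b : R, 0 < b /\ S = Complex a 0 *: p + Complex b 0 *: v].

Definition F_map (R : realType) (kappa : 'cV[R[i]]_2) : flag 'M[R[i]]_2 :=
  flag_of (f_map kappa) (Df_map kappa (Z_map kappa)).

Definition G_map (R : realType) (F : flag 'M[R[i]]_2) : flag 'rV[R]_4 :=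
  Flag (g_map (flag_pt F)) (@g_map R @` flag_plane F) (@g_map R @` flag_orient F).

(** A subset [dbase] with an oriented line field on it: [dlines] is the set of
    pairs (base point, vector in the line at that point) and [dpos] consists of
    the pairs whose vector is positively directed. *)
Record decorated (E : Type) := Decorated {
  dbase : set E;
  dlines : set (E * E);
  dpos : set (E * E) }.

Definition hyperboloid (R : realType) : set 'rV[R]_4 :=
  [set x : 'rV[R]_4 | mink x x = 1 /\ 0 < x 0 0].

Definition h_map (R : realType) (p : 'rV[R]_4) : set 'rV[R]_4 :=
  [set x | hyperboloid x /\ mink x p = 1].

Definition tangent_h (R : realType) (p q : 'rV[R]_4) : set 'rV[R]_4 :=
  [set w | mink q w = 0 /\ mink p w = 0].

(** The projection of [V] to [V / Rp] restricted to [V] intersected with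
    [T_q h(p)] is an isomorphism, so a vector of that intersection is positive
    exactly when it lies in [flag_orient]. *)
Definition H_map (R : realType) (F : flag 'rV[R]_4) : decorated 'rV[R]_4 :=
  let p := flag_pt F in
  Decorated (h_map p)
    [set qw | h_map p qw.1 /\ (flag_plane F `&` tangent_h p qw.1) qw.2]
    [set qw | h_map p qw.1 /\ (flag_orient F `&` tangent_h p qw.1) qw.2].

Definition push (R : realType) (E E' : normedModType R) (phi : E -> E')
    (D : decorated E) : decorated E' :=
  let Tphi := fun qw : E * E => (phi qw.1, 'D_(qw.2) phi qw.1) in
  Decorated (phi @` dbase D) (Tphi @` dlines D) (Tphi @` dpos D).

Definition i_map (R : realType) (x : 'rV[R]_4) : 'rV[R]_3 :=
  (1 + x 0 0)^-1 *: vec3 (x 0 1) (x 0 2) (x 0 3).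

Definition unit_ball (R : realType) : set 'rV[R]_3 := [set q : 'rV[R]_3 | dot3 q q < 1].

Definition upper_half_space (R : realType) : set 'rV[R]_3 := [set q : 'rV[R]_3 | 0 < q 0 2].

(** Squared length of the tangent vector [v] at [q] in the conformal ball. *)
Definition ball_metric (R : realType) (q v : 'rV[R]_3) : R :=
  4 * dot3 v v / (1 - dot3 q q) ^+ 2.

Definition half_space_metric (R : realType) (q u v : 'rV[R]_3) : R :=
  dot3 u v / (q 0 2) ^+ 2.

Definition above (R : realType) (c : R[i]) (t : R) : 'rV[R]_3 :=
  vec3 (complex.Re c) (complex.Im c) t.

(** The isometry from the ball to the upper half space which extends
    [(x, y, z) |-> (x + iy) / (1 - z)] on the unit sphere: inversion in the
    sphere of radius [sqrt 2] about [(0, 0, 1)], followed by [z |-> - z].  See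
    [j_map_bij], [j_map_isometry], [j_map_boundary] and [j_map_continuous]
    below. *)
Definition j_map (R : realType) (q : 'rV[R]_3) : 'rV[R]_3 :=
  ((q 0 0) ^+ 2 + (q 0 1) ^+ 2 + (1 - q 0 2) ^+ 2)^-1 *:
  vec3 (2 * q 0 0) (2 * q 0 1) (1 - dot3 q q).

Definition j_den (R : realType) (q : 'rV[R]_3) : R :=
  q 0 0 ^+ 2 + q 0 1 ^+ 2 + (1 - q 0 2) ^+ 2.

Lemma j_mapE (R : realType) (q : 'rV[R]_3) :
  (j_map q 0 0 = 2 * q 0 0 / j_den q) * (j_map q 0 1 = 2 * q 0 1 / j_den q) *
  (j_map q 0 2 = (1 - dot3 q q) / j_den q).
Proof.
by rewrite /j_map -/(j_den q); split; [split|]; rewrite mxE vec3E mulrC.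
Qed.

Lemma j_den_gt0 (R : realType) (q : 'rV[R]_3) :
  dot3 q q <= 1 -> q 0 2 != 1 -> 0 < j_den q.
Proof. by rewrite /dot3 /j_den => h /eqP h1; nra. Qed.

Lemma ball_j_den (R : realType) (q : 'rV[R]_3) : unit_ball q -> 0 < j_den q.
Proof.
rewrite /unit_ball /= => h; apply: j_den_gt0; first exact: ltW.
by apply/eqP => e; move: h; rewrite /dot3 e; nra.
Qed.

Lemma is_derive_coord3 (R : realType) (q v : 'rV[R]_3) k :
  is_derive q v (fun x : 'rV[R]_3 => x 0 k) (v 0 k).
Proof.
apply: DeriveDef; first exact/diff_derivable/differentiable_coord.
apply: cvg_lim => //; apply: cvg_near_cst; near=> h.
rewrite /= [X in X - _]mxE addrK mxE -[LHS]/(h^-1 * (h * v 0 k)) mulKf //.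
by near: h; exact: nbhs_dnbhs_neq.
Unshelve. all: by end_near. Qed.

Lemma is_derive_inv (R : realType) (f : 'rV[R]_3 -> R) (q v : 'rV[R]_3) (df : R) :
  f q != 0 -> is_derive q v f df ->
  is_derive q v (fun x => (f x)^-1) (- (f q) ^- 2 * df).
Proof.
move=> f0 [dx <-]; apply: DeriveDef; first exact: derivableV.
by rewrite deriveV.
Qed.

Lemma is_derive_coordM (R : realType) (f g : 'rV[R]_3 -> R) (q v : 'rV[R]_3) (df dg : R) :
  is_derive q v f df -> is_derive q v g dg ->
  is_derive q v (fun x => f x * g x) (f q * dg + g q * df).
Proof. exact: is_deriveM. Qed.

Lemma is_derive_coordD (R : realType) (f g : 'rV[R]_3 -> R) (q v : 'rV[R]_3) (df dg : R) :
  is_derive q v f df -> is_derive q v g dg ->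
  is_derive q v (fun x => f x + g x) (df + dg).
Proof. exact: is_deriveD. Qed.

Lemma is_derive_coordB (R : realType) (f g : 'rV[R]_3 -> R) (q v : 'rV[R]_3) (df dg : R) :
  is_derive q v f df -> is_derive q v g dg ->
  is_derive q v (fun x => f x - g x) (df - dg).
Proof. exact: is_deriveB. Qed.

Lemma is_derive_dot (R : realType) (q v : 'rV[R]_3) :
  is_derive q v (fun x : 'rV[R]_3 => dot3 x x) (2 * dot3 q v).
Proof.
have c k := is_derive_coord3 q v k.
have m k := is_derive_coordM (c k) (c k).
have := is_derive_coordD (is_derive_coordD (m 0) (m 1)) (m 2).
move=> /is_derive_eq; apply; rewrite /dot3; ring.
Qed.

Lemma is_derive_row (R : realType) (f : 'rV[R]_3 -> 'rV[R]_3)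
    (q v : 'rV[R]_3) (a b c : R) :
  is_derive q v (fun x => f x 0 0) a -> is_derive q v (fun x => f x 0 1) b ->
  is_derive q v (fun x => f x 0 2) c -> is_derive q v f (vec3 a b c).
Proof.
move=> da db dc.
have hf : derivable f q v.
  apply/derivable_mxP => i k; rewrite (ord1 i).
  case: k => -[|[|[|//]]] Hk; last 1 first.
  - by rewrite (_ : Ordinal Hk = 2) ?(@ex_derive _ _ _ _ _ _ _ dc) //; apply: val_inj.
  - by rewrite (_ : Ordinal Hk = 0) ?(@ex_derive _ _ _ _ _ _ _ da) //; apply: val_inj.
  - by rewrite (_ : Ordinal Hk = 1) ?(@ex_derive _ _ _ _ _ _ _ db) //; apply: val_inj.
apply: DeriveDef => //; rewrite derive_mx //.
by apply: row3P; rewrite mxE vec3E derive_val.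
Qed.

Lemma is_derive_j_map (R : realType) (q v : 'rV[R]_3) : j_den q != 0 ->
  let D := j_den q in
  let dD := 2 * (q 0 0 * v 0 0 + q 0 1 * v 0 1 - (1 - q 0 2) * v 0 2) in
  is_derive q v (@j_map R)
    (vec3 (2 * v 0 0 / D - 2 * q 0 0 * dD / D ^+ 2)
          (2 * v 0 1 / D - 2 * q 0 1 * dD / D ^+ 2)
          (- 2 * dot3 q v / D - (1 - dot3 q q) * dD / D ^+ 2)).
Proof.
move=> D0 D dD.
have c k := is_derive_coord3 q v k.
have hD : is_derive q v (@j_den R) dD.
  have -> : @j_den R = fun x => dot3 x x + (1 - 2 * x 0 2).
    by apply/funext => x; rewrite /j_den /dot3; ring.
  have c2 := is_derive_coordM (is_derive_cst (2 : R) q v) (c 2).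
  have := is_derive_coordD (is_derive_dot q v)
    (is_derive_coordB (is_derive_cst (1 : R) q v) c2).
  move=> /is_derive_eq; apply; rewrite /cst /dD /dot3; ring.
have hI := is_derive_inv D0 hD.
have e0 : (fun x : 'rV[R]_3 => j_map x 0 0) = fun x => 2 * x 0 0 / j_den x.
  by apply/funext => x; rewrite j_mapE.
have e1 : (fun x : 'rV[R]_3 => j_map x 0 1) = fun x => 2 * x 0 1 / j_den x.
  by apply/funext => x; rewrite j_mapE.
have e2 : (fun x : 'rV[R]_3 => j_map x 0 2) = fun x => (1 - dot3 x x) / j_den x.
  by apply/funext => x; rewrite j_mapE.
have k2 := is_derive_cst (2 : R) q v.
apply: is_derive_row; rewrite ?e0 ?e1 ?e2.
- apply: (is_derive_eq (is_derive_coordM (is_derive_coordM k2 (c 0)) hI)).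
  by rewrite /cst /= -/D; field.
- apply: (is_derive_eq (is_derive_coordM (is_derive_coordM k2 (c 1)) hI)).
  by rewrite /cst /= -/D; field.
apply: (is_derive_eq (is_derive_coordM (is_derive_coordB (is_derive_cst (1 : R) q v)
  (is_derive_dot q v)) hI)).
by rewrite /cst /= -/D; field.
Qed.

Lemma j_map_isometry (R : realType) (q v : 'rV[R]_3) : unit_ball q ->
  half_space_metric (j_map q) ('D_v (@j_map R) q) ('D_v (@j_map R) q)
  = ball_metric q v.
Proof.
move=> hq; have D0 := ball_j_den hq.
have [_ ->] := is_derive_j_map v (lt0r_neq0 D0).
have e a b c : dot3 (vec3 a b c) (vec3 a b c) = a ^+ 2 + b ^+ 2 + c ^+ 2 :> R.
  by rewrite {1}/dot3 !vec3E -!expr2.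
have : 1 - dot3 q q != 0 by rewrite subr_eq0 gt_eqF.
rewrite /half_space_metric /ball_metric j_mapE e => h.
have := lt0r_neq0 D0; move: h; rewrite /j_den /dot3 => h1 h2.
field.
by apply/andP.
Qed.

Definition j_inv (R : realType) (u : 'rV[R]_3) : 'rV[R]_3 :=
  (u 0 0 ^+ 2 + u 0 1 ^+ 2 + (1 + u 0 2) ^+ 2)^-1 *:
  vec3 (2 * u 0 0) (2 * u 0 1) (dot3 u u - 1).

Lemma j_invE (R : realType) (u : 'rV[R]_3) :
  let E := u 0 0 ^+ 2 + u 0 1 ^+ 2 + (1 + u 0 2) ^+ 2 in
  (j_inv u 0 0 = 2 * u 0 0 / E) * (j_inv u 0 1 = 2 * u 0 1 / E) *
  (j_inv u 0 2 = (dot3 u u - 1) / E).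
Proof.
by rewrite /j_inv; split; [split|]; rewrite mxE vec3E mulrC.
Qed.

Lemma j_mapK (R : realType) (q : 'rV[R]_3) : unit_ball q -> j_inv (j_map q) = q.
Proof.
move=> hq; have := lt0r_neq0 (ball_j_den hq); rewrite /j_den => D0.
have eE : j_map q 0 0 ^+ 2 + j_map q 0 1 ^+ 2 + (1 + j_map q 0 2) ^+ 2 = 4 / j_den q.
  by rewrite !j_mapE /dot3 /j_den; field.
by apply: row3P; rewrite j_invE eE ?/dot3 !j_mapE /j_den ?/dot3; field.
Qed.

Lemma j_invK (R : realType) (u : 'rV[R]_3) : upper_half_space u ->
  unit_ball (j_inv u) /\ j_map (j_inv u) = u.
Proof.
rewrite /upper_half_space /= => hu.
have E0 : 0 < u 0 0 ^+ 2 + u 0 1 ^+ 2 + (1 + u 0 2) ^+ 2 by nra.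
have E1 := lt0r_neq0 E0.
have eE : j_den (j_inv u) = 4 / (u 0 0 ^+ 2 + u 0 1 ^+ 2 + (1 + u 0 2) ^+ 2).
  by rewrite /j_den !j_invE /dot3; field.
have eN : 1 - dot3 (j_inv u) (j_inv u)
          = 4 * u 0 2 / (u 0 0 ^+ 2 + u 0 1 ^+ 2 + (1 + u 0 2) ^+ 2).
  by rewrite {1}/dot3 !j_invE /dot3; field.
split; first by rewrite /unit_ball /= -subr_gt0 eN divr_gt0 // mulr_gt0.
by apply: row3P; rewrite j_mapE eE ?eN ?j_invE; field.
Qed.

Lemma j_map_bij (R : realType) :
  set_bij (@unit_ball R) (@upper_half_space R) (@j_map R).
Proof.
split.
- move=> q hq; rewrite /upper_half_space /= j_mapE divr_gt0 ?ball_j_den //.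
  by rewrite subr_gt0.
- by move=> p q; rewrite !inE => hp hq e; rewrite -(j_mapK hp) e j_mapK.
- by move=> u /j_invK[hb e]; exists (j_inv u).
Qed.

Lemma j_map_boundary (R : realType) (q : 'rV[R]_3) :
  dot3 q q = 1 -> q 0 2 != 1 ->
  j_map q = above (Complex (q 0 0 / (1 - q 0 2)) (q 0 1 / (1 - q 0 2))) 0.
Proof.
move=> hq h1.
have z1 : 1 - q 0 2 != 0 by rewrite subr_eq0 eq_sym.
have eD : j_den q = 2 * (1 - q 0 2).
  by rewrite /j_den; move: hq; rewrite /dot3 => hq; lra.
by apply: row3P; rewrite j_mapE vec3E eD ?hq /=; field.
Qed.

Lemma j_map_continuous (R : realType) (q : 'rV[R]_3) :
  dot3 q q = 1 -> q 0 2 != 1 -> {for q, continuous (@j_map R)}.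
Proof.
move=> hq h1.
have D0 : j_den q != 0 by apply: lt0r_neq0; apply: j_den_gt0; rewrite ?hq.
have c k : (fun x : 'rV[R]_3 => x 0 k) @ q --> q 0 k by exact: coord_continuous.
have m k : (fun x : 'rV[R]_3 => x 0 k * x 0 k) @ q --> q 0 k * q 0 k.
  exact: cvgM (c k) (c k).
have k2 k : (fun x : 'rV[R]_3 => 2 * x 0 k) @ q --> 2 * q 0 k.
  by apply: cvgM (c k); exact: cvg_cst.
have cdot : (fun x : 'rV[R]_3 => dot3 x x) @ q --> dot3 q q.
  exact: cvgD (cvgD (m 0) (m 1)) (m 2).
have cB (f : 'rV[R]_3 -> R) : f @ q --> f q -> (fun x => 1 - f x) @ q --> 1 - f q.
  by move=> hf; apply: cvgB hf; exact: cvg_cst.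
have cD : @j_den R @ q --> j_den q.
  have e (x : 'rV[R]_3) : j_den x = dot3 x x + (1 - 2 * x 0 2) :> R by rewrite /j_den /dot3; ring.
  have -> : @j_den R = fun x : 'rV[R]_3 => dot3 x x + (1 - 2 * x 0 2).
    by apply/funext => x; exact: e.
  exact: cvgD cdot (cB (fun x => 2 * x 0 2) (k2 2)).
have cI : (fun x : 'rV[R]_3 => (j_den x)^-1) @ q --> (j_den q)^-1 by exact: cvgV D0 cD.
have cj k : (fun x : 'rV[R]_3 => j_map x 0 k) @ q --> j_map q 0 k.
  case: k => -[|[|[|//]]] Hk.
  - rewrite (_ : Ordinal Hk = 0); last exact: val_inj.
    rewrite j_mapE; under eq_fun do rewrite j_mapE.
    exact: cvgM (k2 0) cI.
  - rewrite (_ : Ordinal Hk = 1); last exact: val_inj.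
    rewrite j_mapE; under eq_fun do rewrite j_mapE.
    exact: cvgM (k2 1) cI.
  - rewrite (_ : Ordinal Hk = 2); last exact: val_inj.
    rewrite j_mapE; under eq_fun do rewrite j_mapE.
    exact: cvgM (cB _ cdot) cI.
suff : @j_map R @ q --> j_map q by [].
apply/(@cvgrPdist_le _ 'rV[R]_3 _ (nbhs q) (nbhs_filter q) (@j_map R)) => /= e e0; near=> x.
rewrite /Num.Def.normr/= mx_normrE (bigmax_le _ (ltW e0))//= => -[i k] _.
rewrite (ord1 i) mxE /= [X in _ + X]mxE; move: k; near: x.
by apply: filter_forall => /= k; exact: ((cvgrPdist_le _ _).1 (cj k)).
Unshelve. all: by end_near. Qed.

Definition K_map (R : realType) (kappa : 'cV[R[i]]_2) : decorated 'rV[R]_3 :=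
  push (@j_map R) (push (@i_map R) (H_map (G_map (F_map kappa)))).

(** The boundary is [option R[i]], with [None] for infinity. *)
Inductive horosphere (R : realType) :=
  | HoroPlane of R             (* Euclidean height *)
  | HoroSphere of R[i] & R.    (* point of tangency, Euclidean diameter *)

Definition horo_valid (R : realType) (s : horosphere R) : Prop :=
  match s with HoroPlane h => 0 < h | HoroSphere _ d => 0 < d end.

Definition horo_centre (R : realType) (s : horosphere R) : option R[i] :=
  match s with HoroPlane _ => None | HoroSphere c _ => Some c end.

Definition horo_set (R : realType) (s : horosphere R) : set 'rV[R]_3 :=
  match s with
  | HoroPlane h => [set q : 'rV[R]_3 | q 0 2 = h]
  | HoroSphere c d =>
      [set q : 'rV[R]_3 | 0 < q 0 2 /\
        dot3 (q - above c (d / 2)) (q - above c (d / 2)) = (d / 2) ^+ 2]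
  end.

Definition centred_at (R : realType) (S : set 'rV[R]_3) (c : option R[i]) : Prop :=
  exists s : horosphere R,
    [/\ horo_valid s, S = horo_set s & horo_centre s = c].

Definition north_pole (R : realType) (c : R[i]) (d : R) : 'rV[R]_3 := above c d.

(** The unit normal pointing towards the centre; on a sphere this is the
    normal pointing into the Euclidean ball it bounds. *)
Definition N_out (R : realType) (s : horosphere R) (q : 'rV[R]_3) : 'rV[R]_3 :=
  match s with
  | HoroPlane _ => vec3 0 0 (q 0 2)
  | HoroSphere c d => (q 0 2 / (d / 2)) *: (above c (d / 2) - q)
  end.

Definition N_in (R : realType) (s : horosphere R) (q : 'rV[R]_3) : 'rV[R]_3 :=
  - N_out s q.

(** The oriented line field of [D] at [q] is directed by the complex number
    [w], horizontal tangent vectors [(a, b, 0)] being identified with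
    [a + bi]. *)
Definition specified_at (R : realType) (D : decorated 'rV[R]_3) (q : 'rV[R]_3)
    (w : R[i]) : Prop :=
  [/\ w != 0,
      [set v | dlines D (q, v)] = [set t *: above w 0 | t in [set: R]] &
      [set v | dpos D (q, v)] = [set t *: above w 0 | t in [set t : R | 0 < t]]].

Definition hyp_isometry (R : realType) (phi : 'rV[R]_3 -> 'rV[R]_3) : Prop :=
  [/\ set_bij (@upper_half_space R) (@upper_half_space R) phi,
      (forall q, upper_half_space q -> differentiable phi q),
      (forall q, upper_half_space q -> 0 < \det (jacobian phi q)) &
      (forall q u v, upper_half_space q ->
         half_space_metric (phi q) ('D_u phi q) ('D_v phi q)
         = half_space_metric q u v)].

(** The continuous extension of [phi] to the boundary fixes [c]. *)
Definition fixes_ideal (R : realType) (phi : 'rV[R]_3 -> 'rV[R]_3)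
    (c : option R[i]) : Prop :=
  match c with
  | Some b => phi q @[q --> within (@upper_half_space R) (nbhs (above b 0))]
                --> above b 0
  | None => forall M : R, exists N : R, forall q, upper_half_space q ->
              N < dot3 q q -> M < dot3 (phi q) (phi q)
  end.

Definition parabolic (R : realType) (phi : 'rV[R]_3 -> 'rV[R]_3) : Prop :=
  [/\ hyp_isometry phi,
      (forall q, upper_half_space q -> phi q <> q) &
      exists! c, fixes_ideal phi c].

Definition parallel_on (R : realType) (S : set 'rV[R]_3)
    (V : 'rV[R]_3 -> 'rV[R]_3) : Prop :=
  forall phi, parabolic phi -> phi @` S = S ->
  forall q, S q -> 'D_(V q) phi q = V (phi q).

Definition unit_tangent_parallel (R : realType) (s : horosphere R)
    (V : 'rV[R]_3 -> 'rV[R]_3) : Prop :=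
  [/\ (forall q, horo_set s q -> half_space_metric q (V q) (V q) = 1),
      (forall q, horo_set s q -> half_space_metric q (V q) (N_out s q) = 0) &
      parallel_on (horo_set s) V].

(** Quaternions, as pairs (real part, imaginary part). *)
Notation quat R := (R * 'rV[R]_3)%type.

Definition qmul (R : realType) (s t : quat R) : quat R :=
  (s.1 * t.1 - dot3 s.2 t.2, s.1 *: t.2 + t.1 *: s.2 + cross3 s.2 t.2).

Definition qconj (R : realType) (s : quat R) : quat R := (s.1, - s.2).

Definition unit_quat (R : realType) (s : quat R) : Prop :=
  s.1 ^+ 2 + dot3 s.2 s.2 = 1.

(** The rotation of [R^3] given by the unit quaternion [s]. *)
Definition qrot (R : realType) (s : quat R) (u : 'rV[R]_3) : 'rV[R]_3 :=
  (qmul (qmul s (0, u)) (qconj s)).2.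

(** The orthonormal frame [z e1, z e2, z e3] trivialises the frame bundle, and
    with it the double cover [Spin -> Fr]: a spin frame is a point together with
    a unit quaternion, which [spin_frame] projects to a frame. *)
Definition spin_bundle (R : realType) : set ('rV[R]_3 * quat R) :=
  [set x | upper_half_space x.1 /\ unit_quat x.2].

Definition spin_frame (R : realType) (x : 'rV[R]_3 * quat R)
    : 'rV[R]_3 * 'rV[R]_3 * 'rV[R]_3 :=
  let z := x.1 0 2 in
  (z *: qrot x.2 (vec3 1 0 0), z *: qrot x.2 (vec3 0 1 0),
   z *: qrot x.2 (vec3 0 0 1)).

(** The frame [(N, V, N x V)] at [q], with the cross product of the hyperbolic
    metric at [q]. *)
Definition frame_of (R : realType) (N V : 'rV[R]_3 -> 'rV[R]_3) (q : 'rV[R]_3)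
    : 'rV[R]_3 * 'rV[R]_3 * 'rV[R]_3 :=
  (N q, V q, (q 0 2)^-1 *: cross3 (N q) (V q)).

(** Rotation of a spin frame by the angle [theta] about its second vector:
    the endpoint of the lift of the path of frames rotated by the angles from
    [0] to [theta]. *)
Definition spin_rotate2 (R : realType) (theta : R) (x : 'rV[R]_3 * quat R)
    : 'rV[R]_3 * quat R :=
  (x.1, qmul x.2 (cos (theta / 2), sin (theta / 2) *: vec3 0 1 0)).

Lemma qrotE (R : realType) (s : quat R) (x : 'rV[R]_3) :
  qrot s x = (s.1 ^+ 2 - dot3 s.2 s.2) *: x + (2 * dot3 s.2 x) *: s.2
             + (2 * s.1) *: cross3 s.2 x.
Proof.
apply: row3P; rewrite /qrot /qmul /qconj /cross3 /dot3 /= !(mxE, vec3E) /=; ring.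
Qed.

Lemma qrot_dot (R : realType) (s : quat R) (x y : 'rV[R]_3) :
  dot3 (qrot s x) (qrot s y) = (s.1 ^+ 2 + dot3 s.2 s.2) ^+ 2 * dot3 x y.
Proof. rewrite !qrotE /cross3 /dot3 !(mxE, vec3E) /=; ring. Qed.

Lemma qrot_cross (R : realType) (s : quat R) (x y : 'rV[R]_3) :
  cross3 (qrot s x) (qrot s y)
  = (s.1 ^+ 2 + dot3 s.2 s.2) *: qrot s (cross3 x y).
Proof.
case: s => a u; rewrite !qrotE.
apply: row3P; rewrite /cross3 /dot3 !(mxE, vec3E) /=;
  move: (u 0 0) (u 0 1) (u 0 2) (x 0 0) (x 0 1) (x 0 2) (y 0 0) (y 0 1) (y 0 2)
    => u0 u1 u2 x0 x1 x2 y0 y1 y2; ring.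
Qed.

Lemma qrotM (R : realType) (s t : quat R) (x : 'rV[R]_3) :
  qrot (qmul s t) x = qrot s (qrot t x).
Proof.
case: s t => a u [b w]; rewrite !qrotE.
apply: row3P; rewrite /qmul /cross3 /dot3 /= !(mxE, vec3E) /=;
  move: (u 0 0) (u 0 1) (u 0 2) (w 0 0) (w 0 1) (w 0 2) (x 0 0) (x 0 1) (x 0 2)
    => u0 u1 u2 w0 w1 w2 x0 x1 x2; ring.
Qed.

Lemma spin_frame_orthonormal (R : realType) (x : 'rV[R]_3 * quat R) :
  spin_bundle x ->
  let: (f1, f2, f3) := spin_frame x in
  [/\ half_space_metric x.1 f1 f1 = 1, half_space_metric x.1 f2 f2 = 1,
      half_space_metric x.1 f1 f2 = 0 & f3 = (x.1 0 2)^-1 *: cross3 f1 f2].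
Proof.
case: x => q s [/= hq hs]; rewrite /spin_frame /=.
have z0 : q 0 2 != 0 by exact: lt0r_neq0.
have dZ a (v w : 'rV[R]_3) : dot3 (a *: v) (a *: w) = a ^+ 2 * dot3 v w.
  by rewrite /dot3 !mxE; ring.
have cZ a (v w : 'rV[R]_3) : cross3 (a *: v) (a *: w) = a ^+ 2 *: cross3 v w.
  by apply: row3P; rewrite /cross3 !(mxE, vec3E) /=; ring.
split; rewrite /half_space_metric ?dZ ?qrot_dot ?hs.
- by rewrite /dot3 !vec3E; field.
- by rewrite /dot3 !vec3E; field.
- by rewrite /dot3 !vec3E; field.
rewrite cZ qrot_cross hs scale1r scalerA expr2 mulKf //; congr (_ *: qrot _ _).
by apply: row3P; rewrite /cross3 !(mxE, vec3E) /=; ring.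
Qed.

Lemma spin_frame_rotate2 (R : realType) (theta : R) (x : 'rV[R]_3 * quat R) :
  let: (f1, f2, f3) := spin_frame x in
  spin_frame (spin_rotate2 theta x) =
    (cos theta *: f1 - sin theta *: f3, f2, sin theta *: f1 + cos theta *: f3).
Proof.
case: x => q s /=; rewrite /spin_frame /spin_rotate2 /= !qrotM.
have h := cos2Dsin2 (theta / 2).
have hc : cos theta = cos (theta / 2) ^+ 2 - sin (theta / 2) ^+ 2.
  by rewrite {1}(splitr theta) cosD -!expr2.
have hsn : sin theta = 2 * cos (theta / 2) * sin (theta / 2).
  by rewrite {1}(splitr theta) sinD; ring.
have lin a b (v w : 'rV[R]_3) : qrot s (a *: v + b *: w) = a *: qrot s v + b *: qrot s w.
  by rewrite !qrotE; apply: row3P; rewrite /cross3 /dot3 !(mxE, vec3E) /=; ring.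
have r y : qrot (cos (theta / 2), sin (theta / 2) *: vec3 0 1 0) y =
   vec3 (cos theta * y 0 0 + sin theta * y 0 2) (y 0 1)
        (cos theta * y 0 2 - sin theta * y 0 0).
  rewrite qrotE hc hsn; apply: row3P; rewrite /cross3 /dot3 !(mxE, vec3E) /=; first by ring.
    by transitivity ((cos (theta / 2) ^+ 2 + sin (theta / 2) ^+ 2) * y 0 1); [ring|rewrite h mul1r].
  by ring.
rewrite !r !vec3E !(mulr1, mulr0, add0r, addr0, subr0, sub0r, oppr0).
have -> : vec3 (cos theta) 0 (- sin theta) = cos theta *: vec3 1 0 0 + (- sin theta) *: vec3 0 0 1.
  by apply: row3P; rewrite !(mxE, vec3E) /=; ring.
have -> : vec3 (sin theta) 0 (cos theta) = sin theta *: vec3 1 0 0 + cos theta *: vec3 0 0 1.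
  by apply: row3P; rewrite !(mxE, vec3E) /=; ring.
rewrite !lin; congr (_, _, _); first last.
  by rewrite scalerDr !scalerA !(mulrC (q 0 2)).
by rewrite scaleNr scalerBr !scalerA !(mulrC (q 0 2)).
Qed.

(** Sections of the spin frame bundle over [sbase] are given by their images. *)
Record spin_decorated (R : realType) := SpinDecorated {
  sbase : set 'rV[R]_3;
  W_in : set ('rV[R]_3 * quat R);
  W_out : set ('rV[R]_3 * quat R) }.

(** [W] is the image of a continuous lift to spin frames of the frame field
    [f] on [S]. *)
Definition is_lift (R : realType) (S : set 'rV[R]_3)
    (f : 'rV[R]_3 -> 'rV[R]_3 * 'rV[R]_3 * 'rV[R]_3)
    (W : set ('rV[R]_3 * quat R)) : Prop :=
  exists w : 'rV[R]_3 -> quat R,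
    [/\ {within S, continuous w},
        (forall q, S q -> unit_quat (w q) /\ spin_frame (q, w q) = f q) &
        W = [set (q, w q) | q in S]].

Definition is_spin_decorated (R : realType) (D : spin_decorated R) : Prop :=
  exists s : horosphere R, exists V : 'rV[R]_3 -> 'rV[R]_3,
    [/\ horo_valid s, sbase D = horo_set s & unit_tangent_parallel s V] /\
    [/\ is_lift (sbase D) (frame_of (N_out s) V) (W_out D),
        is_lift (sbase D) (frame_of (N_in s) V) (W_in D),
        W_in D = @spin_rotate2 R pi @` W_out D &
        W_out D = @spin_rotate2 R (- pi) @` W_in D].

(** The decoration underlying a spin decoration, directed by the second vector
    of the frames. *)
Definition decoration (R : realType) (D : spin_decorated R) : decorated 'rV[R]_3 :=
  let V x := (spin_frame x).1.2 in
  Decorated (sbase D)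
    [set qv | exists x t, W_out D x /\ qv = (x.1, t *: V x)]
    [set qv | exists x t, [/\ W_out D x, 0 < t & qv = (x.1, t *: V x)]].

(** The topology on spin-decorated horospheres is the quotient topology under
    the surjection which sends a spin frame to the spin-decorated horosphere
    whose outward decoration passes through it. *)
Definition open_spin_decorated (R : realType) (A : set (spin_decorated R)) : Prop :=
  A `<=` @is_spin_decorated R /\
  exists O : set ('rV[R]_3 * quat R), open O /\
    [set x | exists D, A D /\ W_out D x] = O `&` @spin_bundle R.

Definition spinor_of_rV (R : realType) (x : 'rV[R]_4) : 'cV[R[i]]_2 :=
  spinor (Complex (x 0 0) (x 0 1)) (Complex (x 0 2) (x 0 3)).

(** [Kt] is a continuous lift of [K_map] to spin-decorated horospheres; its
    value at the zero spinor is irrelevant. *)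
Definition is_lift_of_K (R : realType) (Kt : 'cV[R[i]]_2 -> spin_decorated R) : Prop :=
  [/\ (forall kappa, kappa != 0 -> is_spin_decorated (Kt kappa)),
      (forall kappa, kappa != 0 -> decoration (Kt kappa) = K_map kappa) &
      (forall A, open_spin_decorated A ->
         open [set x : 'rV[R]_4 | spinor_of_rV x != 0 /\ A (Kt (spinor_of_rV x))])].

(* Main.v *)
Require Import Defs.
From mathcomp Require Import all_boot all_order all_algebra.
From mathcomp Require Import complex.
From mathcomp Require Import all_classical all_reals all_analysis.
From mathcomp Require Import ring lra.

(** The spin decoration of [Kt kappa] lies over the decoration [K_map kappa], so
    the theorem is a description of [K_map kappa] in the upper half space.

    The composite of the two changes of model is explicit on the hyperboloid:
    with [x = (T, X, Y, Z)] it is [chart x = (X, Y, 1) / (T - Z)], and on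
    tangent vectors its derivative is the quotient rule ([j_i_map],
    [derive_j_i_map]); the point [q] of the upper half space comes from
    [chart_inv q] ([chart_invK], [chartK]).  Hence the horosphere of a null
    vector [p] is the set of [q] with [<chart_inv q, p> = 1].

    For the flag spanned by [p] and [v], with [<p, p> = <p, v> = 0] and
    [<x, p> = 1], a vector [a p + b v] is orthogonal to [x] exactly when
    [a = - b <x, v>].  So the line of the decoration at [x] is directed by
    [flag_dir p v x = v - <x, v> p], positively for [b > 0]; carrying it along
    the chart gives the oriented line field in the upper half space
    ([dlines_push_H], [dpos_push_H]).

    It remains to insert [p] and [v] as functions of [kappa = (xi, eta)].  With
    a point [q] of height [z] above the complex number [c], one finds
    [<chart_inv q, p> = (|eta c - xi|^2 + |eta|^2 z^2) / z].  If [eta != 0] the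
    equation [<chart_inv q, p> = 1] is that of the sphere tangent at [xi / eta]
    with diameter [|eta|^-2], and at its north pole the directing vector is
    [2 |eta|^2 (1 + |xi / eta|^2)] times [i eta^-2] ([K_sphere]).  If [eta = 0]
    it is the plane [z = |xi|^2], and the directing vector is [2 z] times
    [i xi^2] ([K_plane]). *)

Set Implicit Arguments.
Unset Strict Implicit.
Unset Printing Implicit Defensive.

Import Order.TTheory GRing.Theory Num.Theory.
Import numFieldNormedType.Exports.
Local Open Scope classical_set_scope.
Local Open Scope ring_scope.

(** * Derivative of the projection from the hyperboloid to the ball *)

Lemma row4P (R : realType) (u v : 'rV[R]_4) :
  u 0 0 = v 0 0 -> u 0 1 = v 0 1 -> u 0 2 = v 0 2 -> u 0 3 = v 0 3 -> u = v.
Proof.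
move=> e0 e1 e2 e3; apply/rowP => -[k Hk].
case: k Hk => [|[|[|[|//]]]] Hk.
- by rewrite (_ : Ordinal Hk = 0) //; apply: val_inj.
- by rewrite (_ : Ordinal Hk = 1) //; apply: val_inj.
- by rewrite (_ : Ordinal Hk = 2) //; apply: val_inj.
- by rewrite (_ : Ordinal Hk = 3) //; apply: val_inj.
Qed.

Lemma is_derive_coord (R : realType) (n : nat) (x v : 'rV[R]_n.+1) k :
  is_derive x v (fun y : 'rV[R]_n.+1 => y 0 k) (v 0 k).
Proof.
apply: DeriveDef; first exact/diff_derivable/differentiable_coord.
apply: cvg_lim => //; apply: cvg_near_cst; near=> h.
rewrite /= [X in X - _]mxE addrK mxE -[LHS]/(h^-1 * (h * v 0 k)) mulKf //.
by near: h; exact: nbhs_dnbhs_neq.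
Unshelve. all: by end_near. Qed.

Lemma is_derive_row3 (R : realType) (n : nat) (f : 'rV[R]_n.+1 -> 'rV[R]_3)
    (x v : 'rV[R]_n.+1) (a b c : R) :
  is_derive x v (fun y => f y 0 0) a -> is_derive x v (fun y => f y 0 1) b ->
  is_derive x v (fun y => f y 0 2) c -> is_derive x v f (vec3 a b c).
Proof.
move=> da db dc.
have hf : derivable f x v.
  apply/derivable_mxP => i k; rewrite (ord1 i).
  case: k => -[|[|[|//]]] Hk.
  - by rewrite (_ : Ordinal Hk = 0) ?(@ex_derive _ _ _ _ _ _ _ da) //; apply: val_inj.
  - by rewrite (_ : Ordinal Hk = 1) ?(@ex_derive _ _ _ _ _ _ _ db) //; apply: val_inj.
  - by rewrite (_ : Ordinal Hk = 2) ?(@ex_derive _ _ _ _ _ _ _ dc) //; apply: val_inj.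
apply: DeriveDef => //; rewrite derive_mx //.
by apply: row3P; rewrite mxE vec3E derive_val.
Qed.

Lemma is_derive_i_map (R : realType) (x v : 'rV[R]_4) : 1 + x 0 0 != 0 ->
  let dcoord k := v 0 k / (1 + x 0 0) - x 0 k * v 0 0 / (1 + x 0 0) ^+ 2 in
  is_derive x v (@i_map R) (vec3 (dcoord 1) (dcoord 2) (dcoord 3)).
Proof.
move=> t1 dcoord.
have dx k : is_derive x v (fun y : 'rV[R]_4 => (1 + y 0 0)^-1 * y 0 k) (dcoord k).
  have dT : is_derive x v (fun y : 'rV[R]_4 => 1 + y 0 0) (v 0 0).
    have := is_deriveD (is_derive_cst (1 : R) x v) (is_derive_coord x v 0).
    by rewrite add0r.
  have dI : is_derive x v (fun y : 'rV[R]_4 => (1 + y 0 0)^-1)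
      (- (1 + x 0 0) ^- 2 * v 0 0).
    case: dT => dT <-; apply: DeriveDef; first exact: derivableV.
    by rewrite deriveV.
  apply: (is_derive_eq (is_deriveM dI (is_derive_coord x v k))).
  by rewrite /dcoord /GRing.scale /=; field.
apply: is_derive_row3.
- by under eq_fun do rewrite mxE vec3E.
- by under eq_fun do rewrite mxE vec3E.
- by under eq_fun do rewrite mxE vec3E.
Qed.

(** * From the hyperboloid to the upper half space *)

Definition chart (R : realType) (x : 'rV[R]_4) : 'rV[R]_3 :=
  (x 0 0 - x 0 3)^-1 *: vec3 (x 0 1) (x 0 2) 1.

(** The derivative of [chart] at [x] in the direction [v]. *)
Definition dchart (R : realType) (x v : 'rV[R]_4) : 'rV[R]_3 :=
  (x 0 0 - x 0 3)^-1 *: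
    (vec3 (v 0 1) (v 0 2) 0 - (v 0 0 - v 0 3) *: chart x).

Definition chart_inv (R : realType) (q : 'rV[R]_3) : 'rV[R]_4 :=
  (2 * q 0 2)^-1 *:
    vec4 (dot3 q q + 1) (2 * q 0 0) (2 * q 0 1) (dot3 q q - 1).

Lemma hyperboloid_light_gt0 (R : realType) (x : 'rV[R]_4) :
  hyperboloid x -> 0 < x 0 0 - x 0 3.
Proof. rewrite /hyperboloid /mink /= => -[h h0]; nra. Qed.

(** On the hyperboloid [(T - Z) (T + Z) = 1 + X^2 + Y^2], so [T - Z], [X] and [Y]
    determine the point. *)
Lemma hyperboloid_light (R : realType) (x : 'rV[R]_4) : hyperboloid x ->
  x 0 0 + x 0 3 = (1 + x 0 1 ^+ 2 + x 0 2 ^+ 2) / (x 0 0 - x 0 3).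
Proof.
move=> hx; have L0 := lt0r_neq0 (hyperboloid_light_gt0 hx).
apply: (mulIf L0); rewrite divfK //.
by case: hx; rewrite /mink => h _; lra.
Qed.

Lemma hyperboloid_time_gt0 (R : realType) (x : 'rV[R]_4) :
  hyperboloid x -> 0 < 1 + x 0 0.
Proof. by case=> _ h; lra. Qed.

Lemma j_den_i_map (R : realType) (x : 'rV[R]_4) : hyperboloid x ->
  j_den (i_map x) = 2 * (x 0 0 - x 0 3) / (1 + x 0 0).
Proof.
move=> hx; have T0 := lt0r_neq0 (hyperboloid_time_gt0 hx).
case: hx; rewrite /mink => h _.
rewrite /j_den /i_map !mxE /=; apply: (mulIf (expf_neq0 2 T0)).
transitivity (x 0 1 ^+ 2 + x 0 2 ^+ 2 + (1 + x 0 0 - x 0 3) ^+ 2); first by field.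
by transitivity (2 * (x 0 0 - x 0 3) * (1 + x 0 0)); [lra | field].
Qed.

Lemma one_sub_dot_i_map (R : realType) (x : 'rV[R]_4) : hyperboloid x ->
  1 - dot3 (i_map x) (i_map x) = 2 / (1 + x 0 0).
Proof.
move=> hx; have T0 := lt0r_neq0 (hyperboloid_time_gt0 hx).
case: hx; rewrite /mink => h _.
rewrite /dot3 /i_map !mxE /=; apply: (mulIf (expf_neq0 2 T0)).
transitivity ((1 + x 0 0) ^+ 2 - x 0 1 ^+ 2 - x 0 2 ^+ 2 - x 0 3 ^+ 2); first by field.
by transitivity (2 * (1 + x 0 0)); [lra | field].
Qed.

Lemma j_i_map (R : realType) (x : 'rV[R]_4) : hyperboloid x ->
  j_map (i_map x) = chart x.
Proof.
move=> hx; have L0 := lt0r_neq0 (hyperboloid_light_gt0 hx).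
have T0 := lt0r_neq0 (hyperboloid_time_gt0 hx).
apply: row3P; rewrite j_mapE j_den_i_map // ?one_sub_dot_i_map // /chart !mxE /=;
  by field; apply/andP.
Qed.

(** The two sides are different rational functions of the coordinates, and agree
    only modulo [<x, x> = 1] and [<x, v> = 0].  These two equations give
    [T + Z] and its variation in terms of [T - Z], [X], [Y] and their
    variations; after that substitution the identity is one of rational
    functions. *)
Lemma derive_j_i_map (R : realType) (x v : 'rV[R]_4) :
  hyperboloid x -> mink x v = 0 ->
  'D_('D_v (@i_map R) x) (@j_map R) (i_map x) = dchart x v.
Proof.
move=> hx hv; have L0 := lt0r_neq0 (hyperboloid_light_gt0 hx).
have T0 := lt0r_neq0 (hyperboloid_time_gt0 hx).
have D0 : j_den (i_map x) != 0.
  rewrite j_den_i_map //; apply: mulf_neq0; last by rewrite invr_eq0.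
  by rewrite mulf_neq0 ?pnatr_eq0.
have [_ ->] := is_derive_i_map v T0.
set w := vec3 _ _ _; have [_ ->] := is_derive_j_map w D0.
rewrite j_den_i_map // one_sub_dot_i_map //.
have eP := hyperboloid_light hx.
have eP' : v 0 0 + v 0 3 = (2 * (x 0 1 * v 0 1 + x 0 2 * v 0 2)
    - (1 + x 0 1 ^+ 2 + x 0 2 ^+ 2) / (x 0 0 - x 0 3) * (v 0 0 - v 0 3))
    / (x 0 0 - x 0 3).
  by apply: (mulIf L0); rewrite divfK // -eP; move: hv; rewrite /mink; lra.
set L := x 0 0 - x 0 3; set L' := v 0 0 - v 0 3.
have eT : x 0 0 = (L + (x 0 0 + x 0 3)) / 2 by rewrite /L; field.
have eZ : x 0 3 = ((x 0 0 + x 0 3) - L) / 2 by rewrite /L; field.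
have eT' : v 0 0 = (L' + (v 0 0 + v 0 3)) / 2 by rewrite /L'; field.
have eZ' : v 0 3 = ((v 0 0 + v 0 3) - L') / 2 by rewrite /L'; field.
rewrite eP -/L in eT eZ; rewrite eP' -/L -/L' in eT' eZ'.
have Lgt0 : 0 < L by exact: hyperboloid_light_gt0.
have den0 : L * 2 + (L * L + (1 + x 0 1 ^+ 2 + x 0 2 ^+ 2)) != 0.
  by apply: lt0r_neq0; nra.
move: L0; rewrite -/L => L0.
apply: row3P; rewrite /dchart /chart /w /dot3 /i_map !mxE /= -/L -/L' eT eZ eT' eZ';
  by field; apply/andP.
Qed.

Lemma chart_inv_light (R : realType) (q : 'rV[R]_3) : upper_half_space q ->
  chart_inv q 0 0 - chart_inv q 0 3 = (q 0 2)^-1.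
Proof. by move/lt0r_neq0 => q0; rewrite !mxE /=; field. Qed.

Lemma chart_invK (R : realType) (q : 'rV[R]_3) : upper_half_space q ->
  hyperboloid (chart_inv q) /\ chart (chart_inv q) = q.
Proof.
rewrite /upper_half_space /= => hq; have q0 := lt0r_neq0 hq.
split.
  split; rewrite /mink !mxE /=.
    by rewrite /dot3; field.
  by rewrite mulr_gt0 // ?invr_gt0; rewrite /dot3; nra.
by apply: row3P; rewrite /chart chart_inv_light // !mxE /=; field.
Qed.

Lemma dchart_chart_inv (R : realType) (q : 'rV[R]_3) (v : 'rV[R]_4) :
  upper_half_space q ->
  dchart (chart_inv q) v = q 0 2 *: (vec3 (v 0 1) (v 0 2) 0 - (v 0 0 - v 0 3) *: q).
Proof.
by move=> hq; rewrite /dchart chart_inv_light // invrK; have [_ ->] := chart_invK hq.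
Qed.

Lemma chartK (R : realType) (x : 'rV[R]_4) : hyperboloid x ->
  upper_half_space (chart x) /\ chart_inv (chart x) = x.
Proof.
move=> hx; have L0 := lt0r_neq0 (hyperboloid_light_gt0 hx).
split; first by rewrite /upper_half_space /= !mxE /= mulr1 invr_gt0 hyperboloid_light_gt0.
have hP := hyperboloid_light hx.
have e : dot3 (chart x) (chart x) = (x 0 0 + x 0 3) / (x 0 0 - x 0 3).
  by rewrite hP /dot3 !mxE /=; field.
by apply: row4P; rewrite !mxE /= ?e; field.
Qed.

(** * Decorated horosphere of a flag *)

(** [[p, v]] in Minkowski space. *)
Definition real_flag (R : realType) (p v : 'rV[R]_4) : flag 'rV[R]_4 :=
  Flag p
    [set x | exists a b : R, x = a *: p + b *: v]
    [set x | exists a b : R, 0 < b /\ x = a *: p + b *: v].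

Lemma minkDr (R : realType) (x y z : 'rV[R]_4) :
  mink x (y + z) = mink x y + mink x z.
Proof. by rewrite /mink !mxE; ring. Qed.

Lemma minkZr (R : realType) (a : R) (x y : 'rV[R]_4) :
  mink x (a *: y) = a * mink x y.
Proof. by rewrite /mink !mxE; ring. Qed.

Lemma dchartZ (R : realType) (a : R) (x v : 'rV[R]_4) :
  dchart x (a *: v) = a *: dchart x v.
Proof. by apply: row3P; rewrite !mxE /=; ring. Qed.

(** The representative of the class of [v] modulo [p] which is tangent at [x] to
    the horosphere of [p], when [<x, p> = 1]. *)
Definition flag_dir (R : realType) (p v : 'rV[R]_4) (x : 'rV[R]_4) : 'rV[R]_4 :=
  v - mink x v *: p.

Lemma flag_plane_tangent (R : realType) (p v x : 'rV[R]_4) : mink x p = 1 ->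
  forall a b, tangent_h p x (a *: p + b *: v) ->
  a *: p + b *: v = b *: flag_dir p v x.
Proof.
move=> xp a b [+ _]; rewrite minkDr !minkZr xp mulr1 /flag_dir.
move=> /eqP; rewrite addr_eq0 => /eqP ->.
by rewrite scalerBr scalerA scaleNr addrC.
Qed.

Lemma flag_dir_tangent (R : realType) (p v x : 'rV[R]_4) :
  mink p p = 0 -> mink p v = 0 -> mink x p = 1 ->
  forall b, tangent_h p x (b *: flag_dir p v x).
Proof.
move=> pp pv xp b; rewrite /flag_dir -scaleNr; split;
  by rewrite minkZr minkDr minkZr ?xp ?pp ?pv; ring.
Qed.

Definition half_space_decorated (R : realType) (p v : 'rV[R]_4) :
    decorated 'rV[R]_3 :=
  push (@j_map R) (push (@i_map R) (H_map (real_flag p v))).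

Lemma dbase_push_H (R : realType) (p v : 'rV[R]_4) :
  dbase (half_space_decorated p v)
  = [set q | upper_half_space q /\ mink (chart_inv q) p = 1].
Proof.
apply/seteqP; split => [q [y [x [hx xp] <-] <-]|q [/chart_invK[hx e] xp]] /=.
  by rewrite j_i_map //; have [? ->] := chartK hx.
exists (i_map (chart_inv q)); last by rewrite j_i_map.
by exists (chart_inv q).
Qed.

(** A point [q] has a single preimage in the hyperboloid, so the vectors attached
    to [q] by pushing a family [P] forward all come from [P (chart_inv q)].  Both
    the line field and its positive half are of this form, with [S] all of the
    real line or its positive half. *)
Lemma push_fibre (R : realType) (p v : 'rV[R]_4)
    (P : 'rV[R]_4 -> set 'rV[R]_4) (S : set R) (q : 'rV[R]_3) :
  mink p p = 0 -> mink p v = 0 ->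
  (forall x, h_map p x -> P x = [set b *: flag_dir p v x | b in S]) ->
  upper_half_space q -> mink (chart_inv q) p = 1 ->
  [set u | exists2 y, exists2 z : 'rV[R]_4 * 'rV[R]_4, h_map p z.1 /\ P z.1 z.2 &
      (i_map z.1, 'D_(z.2) (@i_map R) z.1) = y &
      (j_map y.1, 'D_(y.2) (@j_map R) y.1) = (q, u)]
  = [set b *: dchart (chart_inv q) (flag_dir p v (chart_inv q)) | b in S].
Proof.
move=> pp pv hP hq hqp; have [hx ex] := chart_invK hq.
apply/seteqP; split => [u [_ [[x w] /= [[hx' xp] Pw] <-]] /= [] |_ [b Sb <-]] /=.
  rewrite j_i_map // => eq eu; have [_ ex'] := chartK hx'; rewrite -eq ex' -eu.
  move: Pw; rewrite hP //= => -[b Sb <-]; exists b => //.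
  rewrite derive_j_i_map ?dchartZ //.
  by case: (flag_dir_tangent pp pv xp b).
have [t0 t1] := flag_dir_tangent pp pv hqp b.
exists (i_map (chart_inv q),
  'D_(b *: flag_dir p v (chart_inv q)) (@i_map R) (chart_inv q)).
  exists (chart_inv q, b *: flag_dir p v (chart_inv q)) => //=.
  by split=> //; rewrite hP //=; exists b.
by rewrite /= j_i_map // ex derive_j_i_map // dchartZ.
Qed.

Lemma dlines_push_H (R : realType) (p v : 'rV[R]_4) (q : 'rV[R]_3) :
  mink p p = 0 -> mink p v = 0 ->
  upper_half_space q -> mink (chart_inv q) p = 1 ->
  [set u | dlines (half_space_decorated p v) (q, u)]
  = [set b *: dchart (chart_inv q) (flag_dir p v (chart_inv q)) | b in [set: R]].
Proof.
move=> pp pv hq hqp.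
apply: (@push_fibre R p v
  (fun x => flag_plane (real_flag p v) `&` tangent_h p x)) => //.
move=> x [hx xp]; apply/seteqP; split=> [w [[a [b ->]] tw]|w [b _ <-]] /=.
  by exists b => //; rewrite (flag_plane_tangent xp).
split; last exact: flag_dir_tangent.
by exists (- b * mink x v), b; rewrite /flag_dir scalerBr scalerA mulNr scaleNr addrC.
Qed.

Lemma dpos_push_H (R : realType) (p v : 'rV[R]_4) (q : 'rV[R]_3) :
  mink p p = 0 -> mink p v = 0 ->
  upper_half_space q -> mink (chart_inv q) p = 1 ->
  [set u | dpos (half_space_decorated p v) (q, u)]
  = [set b *: dchart (chart_inv q) (flag_dir p v (chart_inv q))
      | b in [set b | 0 < b]].
Proof.
move=> pp pv hq hqp.
apply: (@push_fibre R p v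
  (fun x => flag_orient (real_flag p v) `&` tangent_h p x)) => //.
move=> x [hx xp]; apply/seteqP; split=> [w [[a [b [b0 ->]]] tw]|w [b b0 <-]] /=.
  by exists b => //; rewrite (flag_plane_tangent xp).
split; last exact: flag_dir_tangent.
by exists (- b * mink x v), b; split=> //;
  rewrite /flag_dir scalerBr scalerA mulNr scaleNr addrC.
Qed.

(** * Flags of spinors *)

Lemma spinorE (R : realType) (kappa : 'cV[R[i]]_2) :
  kappa = spinor (kappa 0 0) (kappa 1 0).
Proof.
by apply/colP => -[[|[|//]] Hk]; rewrite !mxE /=; congr (kappa _ _); apply: val_inj.
Qed.

Lemma g_mapZD (R : realType) (a b : R) (S S' : 'M[R[i]]_2) :
  g_map (Complex a 0 *: S + Complex b 0 *: S') = a *: g_map S + b *: g_map S'.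
Proof.
have reE (u w : R[i]) : complex.Re (Complex a 0 * u + Complex b 0 * w)
    = a * complex.Re u + b * complex.Re w.
  by case: u w => [u1 u2] [w1 w2] /=; ring.
have imE (u w : R[i]) : complex.Im (Complex a 0 * u + Complex b 0 * w)
    = a * complex.Im u + b * complex.Im w.
  by case: u w => [u1 u2] [w1 w2] /=; ring.
by rewrite /g_map; apply: row4P; rewrite !mxE !(reE, imE) /=; ring.
Qed.

Lemma G_flag_of (R : realType) (S T : 'M[R[i]]_2) :
  G_map (flag_of S T) = real_flag (g_map S) (g_map T).
Proof.
rewrite /G_map /real_flag /=; congr Flag.
  apply/seteqP; split=> [_ [_ [a [b ->]] <-]|_ [a [b ->]]] /=.
    by exists a, b; rewrite g_mapZD.
  by rewrite -g_mapZD; eexists; [exists a, b|].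
apply/seteqP; split=> [_ [_ [a [b [b0 ->]]] <-]|_ [a [b [b0 ->]]]] /=.
  by exists a, b; rewrite g_mapZD.
by rewrite -g_mapZD; eexists; [exists a, b|].
Qed.

Lemma g_f_map (R : realType) (a b c d : R) :
  g_map (f_map (spinor (Complex a b) (Complex c d)))
  = vec4 (a ^+ 2 + b ^+ 2 + (c ^+ 2 + d ^+ 2)) (2 * (a * c + b * d))
         (2 * (b * c - a * d)) (a ^+ 2 + b ^+ 2 - (c ^+ 2 + d ^+ 2)).
Proof.
by apply: row4P; rewrite /g_map !mxE !big_ord1 !mxE /=; ring.
Qed.

Lemma g_Df_map (R : realType) (a b c d : R) :
  let kappa := spinor (Complex a b) (Complex c d) in
  g_map (Df_map kappa (Z_map kappa))
  = vec4 0 (4 * (c * d - a * b)) (2 * (a ^+ 2 - b ^+ 2 + c ^+ 2 - d ^+ 2))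
         (4 * (a * d + b * c)).
Proof.
by apply: row4P; rewrite /g_map !mxE !big_ord1 !mxE /=; ring.
Qed.

(** The form [<g S, g S>] is four times the determinant of [S], and [f_map kappa]
    has rank one. *)
Lemma mink_gf_gf (R : realType) (kappa : 'cV[R[i]]_2) :
  mink (g_map (f_map kappa)) (g_map (f_map kappa)) = 0.
Proof.
rewrite (spinorE kappa); case: (kappa 0 0) (kappa 1 0) => a b [c d].
by rewrite g_f_map /mink !mxE /=; ring.
Qed.

(** The derivative of the null vector [g_map (f_map kappa)] is tangent to the
    light cone. *)
Lemma mink_gf_gDf (R : realType) (kappa : 'cV[R[i]]_2) :
  mink (g_map (f_map kappa)) (g_map (Df_map kappa (Z_map kappa))) = 0.
Proof.
rewrite (spinorE kappa); case: (kappa 0 0) (kappa 1 0) => a b [c d].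
by rewrite g_f_map g_Df_map /mink !mxE /=; ring.
Qed.

(** A vector directing the decoration [K_map kappa] at [q]. *)
Definition K_dir (R : realType) (kappa : 'cV[R[i]]_2) (q : 'rV[R]_3) : 'rV[R]_3 :=
  dchart (chart_inv q)
    (flag_dir (g_map (f_map kappa)) (g_map (Df_map kappa (Z_map kappa)))
       (chart_inv q)).

Lemma dbase_K (R : realType) (kappa : 'cV[R[i]]_2) :
  dbase (K_map kappa) =
  [set q | upper_half_space q /\ mink (chart_inv q) (g_map (f_map kappa)) = 1].
Proof. by rewrite /K_map /F_map G_flag_of dbase_push_H. Qed.

Lemma image_scaleZ (R : realType) (V : lmodType R) (k : R) (w : V) : 0 < k ->
  [set b *: (k *: w) | b in [set: R]] = [set t *: w | t in [set: R]] /\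
  [set b *: (k *: w) | b in [set t | 0 < t]] = [set t *: w | t in [set t | 0 < t]].
Proof.
move=> k0; split; apply/seteqP; split=> _ [b b0 <-].
- by exists (b * k); rewrite ?scalerA.
- by exists (b / k); rewrite ?scalerA // divfK ?gt_eqF.
- by exists (b * k); rewrite ?scalerA //= mulr_gt0.
- by exists (b / k); rewrite ?scalerA ?divfK ?gt_eqF //= divr_gt0.
Qed.

Lemma specified_K (R : realType) (kappa : 'cV[R[i]]_2) (q : 'rV[R]_3) (k : R) (w : R[i]) :
  dbase (K_map kappa) q -> w != 0 -> 0 < k -> K_dir kappa q = k *: above w 0 ->
  specified_at (K_map kappa) q w.
Proof.
rewrite dbase_K => -[hq hqp] w0 k0 e.
have [e1 e2] := image_scaleZ (above w 0) k0.
have pp := mink_gf_gf kappa; have pv := mink_gf_gDf kappa.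
split=> //; rewrite /K_map /F_map G_flag_of.
  by rewrite dlines_push_H // -/(K_dir kappa q) e.
by rewrite dpos_push_H // -/(K_dir kappa q) e.
Qed.

(** * Horospheres of spinors in the upper half space *)

Lemma normc_sqr (R : realType) (c d : R) :
  Normc.normc (Complex c d) ^+ 2 = c ^+ 2 + d ^+ 2.
Proof. by rewrite /Normc.normc sqr_sqrtr // addr_ge0 ?sqr_ge0. Qed.

(** The spinor is written with [zeta = xi / eta] as a parameter, so that
    [|eta|^2] is the only denominator in what follows. *)
Lemma K_sphere (R : realType) (zeta eta : R[i]) : eta != 0 ->
  let kappa := spinor (zeta * eta) eta in
  let d := Normc.normc eta ^- 2 in
  dbase (K_map kappa) = horo_set (HoroSphere zeta d) /\
  specified_at (K_map kappa) (north_pole zeta d) (Complex 0 1 * eta ^- 2).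
Proof.
case: zeta eta => [s t] [c d] eta0 kappa diam; rewrite /diam normc_sqr {diam}.
set N := c ^+ 2 + d ^+ 2.
have N0 : 0 < N.
  rewrite lt_def addr_ge0 ?sqr_ge0 // andbT; apply: contra eta0.
  by rewrite paddr_eq0 ?sqr_ge0 // !sqrf_eq0 => /andP[/eqP-> /eqP->].
have kE : kappa = spinor (Complex (s * c - t * d) (s * d + t * c)) (Complex c d) by [].
have N1 := lt0r_neq0 N0.
have base : dbase (K_map kappa) = horo_set (HoroSphere (Complex s t) N^-1).
  rewrite dbase_K /= kE g_f_map; apply: eq_set => q; apply/propext.
  rewrite /upper_half_space /=.
  set E := (q 0 0 - s) ^+ 2 + (q 0 1 - t) ^+ 2 + q 0 2 ^+ 2.
  have eS : dot3 (q - above (Complex s t) (N^-1 / 2))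
                 (q - above (Complex s t) (N^-1 / 2))
      = (E - q 0 2 / N) + (N^-1 / 2) ^+ 2.
    by rewrite /E /dot3 !mxE /=; field.
  have -> : (dot3 (q - above (Complex s t) (N^-1 / 2))
                  (q - above (Complex s t) (N^-1 / 2))
      = (N^-1 / 2) ^+ 2) = (E = q 0 2 / N).
    by rewrite eS; apply/propext; split=> [h|->]; lra.
  split=> -[q0 h]; split=> //; have q1 := lt0r_neq0 q0; move: h; set p := vec4 _ _ _ _;
    (have -> : mink (chart_inv q) p = N * E / q 0 2
       by rewrite /mink /p /E /N !mxE /= /dot3; field).
    by move=> h; apply: (mulfI N1); apply: (mulIf (invr_neq0 q1)); rewrite h; field; apply/andP.
  by move=> ->; field; apply/andP.
split=> //; apply: (@specified_K _ _ _ (2 * N * (1 + s ^+ 2 + t ^+ 2))).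
- rewrite base /north_pole /=; split; first by rewrite !mxE invr_gt0.
  by rewrite /dot3 !mxE /=; field.
- by rewrite mulf_neq0 ?invr_eq0 ?expf_neq0 // eq_complex /= oner_eq0 andbF.
- by rewrite !mulr_gt0 //; nra.
have -> : Complex 0 1 * (Complex c d) ^- 2
    = Complex (2 * c * d / N ^+ 2) ((c ^+ 2 - d ^+ 2) / N ^+ 2).
  have NN : (c * c - d * d) ^+ 2 + (c * d + d * c) ^+ 2 = N ^+ 2 by rewrite /N; ring.
  by apply/eqP; rewrite eq_complex /= NN; apply/andP; split; apply/eqP; field.
rewrite /K_dir /flag_dir kE g_f_map g_Df_map.
rewrite dchart_chart_inv; last by rewrite /upper_half_space /= !mxE /= invr_gt0.
set q := north_pole _ _; set v := vec4 0 _ _ _.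
(* Tangency at the north pole: the variation of [T - Z] along
   [flag_dir p v x], where [x = chart_inv q], has to vanish, and this fixes
   [<x, v>] to be [- 2 Im (xi eta) / |eta|^2]. *)
have -> : mink (chart_inv q) v = - (2 * ((s * c - t * d) * d + (s * d + t * c) * c) / N).
  rewrite /mink /v !mxE /= /dot3 /q /north_pole /above !mxE /= /N; field.
  by rewrite -/N.
by apply: row3P; rewrite /v /q /north_pole !mxE /= /N; field; rewrite -/N.
Qed.

Lemma K_plane (R : realType) (xi : R[i]) : xi != 0 ->
  let kappa := spinor xi 0 in
  let h := Normc.normc xi ^+ 2 in
  dbase (K_map kappa) = horo_set (HoroPlane h) /\
  forall q, dbase (K_map kappa) q ->
    specified_at (K_map kappa) q (Complex 0 1 * xi ^+ 2).
Proof.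
case: xi => [a b] xi0 kappa h; rewrite /h normc_sqr {h}.
have N0 : 0 < a ^+ 2 + b ^+ 2.
  rewrite lt_def addr_ge0 ?sqr_ge0 // andbT; apply: contra xi0.
  by rewrite paddr_eq0 ?sqr_ge0 // !sqrf_eq0 => /andP[/eqP-> /eqP->].
have base : dbase (K_map kappa) = horo_set (HoroPlane (a ^+ 2 + b ^+ 2)).
  rewrite dbase_K /= /kappa g_f_map; apply: eq_set => q; apply/propext.
  have e (q0 : q 0 2 != 0) :
      mink (chart_inv q) (vec4 (a ^+ 2 + b ^+ 2 + (0 ^+ 2 + 0 ^+ 2)) (2 * (a * 0 + b * 0))
         (2 * (b * 0 - a * 0)) (a ^+ 2 + b ^+ 2 - (0 ^+ 2 + 0 ^+ 2)))
    = (a ^+ 2 + b ^+ 2) / q 0 2.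
    by rewrite /mink !mxE /= /dot3; field.
  rewrite /upper_half_space /=; split=> [[q0]|qN].
    by rewrite e ?lt0r_neq0 // => h; rewrite -[RHS](divfK (lt0r_neq0 q0)) h mul1r.
  by split; rewrite ?e qN ?divff ?lt0r_neq0.
split=> // q hq; have qN : q 0 2 = a ^+ 2 + b ^+ 2 by move: hq; rewrite base.
apply: (@specified_K _ _ _ (2 * q 0 2)) => //; rewrite ?qN.
- by rewrite mulf_neq0 ?expf_neq0 // eq_complex /= oner_eq0 andbF.
- by rewrite mulr_gt0.
rewrite /K_dir /flag_dir /kappa g_f_map g_Df_map dchart_chart_inv; last first.
  by rewrite /upper_half_space /= qN.
by apply: row3P; rewrite !mxE /= qN; ring.
Qed.

Unset Implicit Arguments.

Theorem theorem2 (R : realType) (Kt : 'cV[R[i]]_2 -> spin_decorated R)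
    (hKt : is_lift_of_K Kt) (xi eta : R[i]) (hk : spinor xi eta != 0) :
  let D := Kt (spinor xi eta) in
  [/\ is_spin_decorated D,
      centred_at (sbase D) (if eta == 0 then None else Some (xi / eta)),
      (eta != 0 ->
         sbase D = horo_set (HoroSphere (xi / eta) ((Normc.normc eta) ^- 2)) /\
         specified_at (decoration D)
           (north_pole (xi / eta) ((Normc.normc eta) ^- 2))
           (Complex 0 1 * eta ^- 2)) &
      (eta = 0 ->
         sbase D = horo_set (HoroPlane ((Normc.normc xi) ^+ 2)) /\
         (forall q, sbase D q ->
            specified_at (decoration D) q (Complex 0 1 * xi ^+ 2)))].
Proof.
move=> D; have [spinD decoD _] := hKt.
have DK : decoration D = K_map (spinor xi eta) by exact: decoD.
have baseD : sbase D = dbase (K_map (spinor xi eta)) by rewrite -DK.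
have sphere : eta != 0 ->
    sbase D = horo_set (HoroSphere (xi / eta) ((Normc.normc eta) ^- 2)) /\
    specified_at (decoration D)
      (north_pole (xi / eta) ((Normc.normc eta) ^- 2)) (Complex 0 1 * eta ^- 2).
  move=> eta0; rewrite baseD DK.
  by have := K_sphere (xi / eta) eta0; rewrite divfK.
have xi0 : eta = 0 -> xi != 0.
  move=> e; apply: contra hk => /eqP ->; rewrite e.
  by apply/eqP/colP => k; rewrite !mxE; case: k => -[|[|]].
have plane : eta = 0 ->
    sbase D = horo_set (HoroPlane ((Normc.normc xi) ^+ 2)) /\
    (forall q, sbase D q ->
       specified_at (decoration D) q (Complex 0 1 * xi ^+ 2)).
  by move=> e; rewrite baseD DK e; apply: K_plane; exact: xi0.
have normc_sqr_gt0 (u : R[i]) : u != 0 -> 0 < Normc.normc u ^+ 2.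
  move=> u0; rewrite lt_def sqr_ge0 andbT expf_eq0 /=.
  by apply: contra u0 => /eqP/Normc.eq0_normc ->.
split=> //; first exact: spinD.
have [e|e] := eqVneq eta 0.
  exists (HoroPlane (Normc.normc xi ^+ 2)); split=> //; last by case: (plane e).
  exact/normc_sqr_gt0/xi0.
exists (HoroSphere (xi / eta) (Normc.normc eta ^- 2)); split=> //.
  by rewrite /= invr_gt0 normc_sqr_gt0.
by case: (sphere e).
Qed.
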